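(* Let $A=[a_{st}]\in\mathcal{PM}(n)$, $B\in\mathcal{PM}(m)$ and $i\in[n]$. Write $A_{11}=A[\{1,\dots,i-1\}]$, $A_{22}=A[\{i+1,\dots,n\}]$ and $A_{21}=A[\{i+1,\dots,n\}\mid\{1,\dots,i-1\}]$. Let $U$ be an $m\times(i-1)$ matrix and $V$ an $(n-i)\times m$ matrix, and let $C$ be the $(n+m-1)\times(n+m-1)$ matrix $$C=\begin{pmatrix}A_{11}&\mathbb{O}&\mathbb{O}\\ U&B&\mathbb{O}\\ A_{21}&V&A_{22}\end{pmatrix}.$$ Suppose that the triple $(U,V,A_{21})$ is one of the following seven triples (where $\mathbb{J}$ is the all-ones matrix and $\mathbb{O}$ the zero matrix of the appropriate size): $(\mathbb{J},\mathbb{J},\mathbb{J})$, $(\mathbb{O},\mathbb{O},\mathbb{J})$, $(\mathbb{J},\mathbb{O},\mathbb{J})$, $(\mathbb{O},\mathbb{J},\mathbb{J})$, $(\mathbb{O},\mathbb{O},\mathbb{O})$, $(\mathbb{O},\mathbb{J},\mathbb{O})$, $(\mathbb{J},\mathbb{O},\mathbb{O})$. Then in all seven cases $C$ is a poset matrix, i.e. $C\in\mathcal{PM}(n+m-1)$.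
   Context: A poset matrix of order $n$ is an $n\times n$ $(0,1)$-matrix $A=[a_{st}]$ that is lower triangular with all diagonal entries equal to $1$ and is transitive: $a_{st}=1$ and $a_{tu}=1$ imply $a_{su}=1$. $\mathcal{PM}(n)$ denotes the set of all $n\times n$ poset matrices. For index sets $\alpha,\beta$, $A[\alpha\mid\beta]$ is the submatrix with rows in $\alpha$ and columns in $\beta$ (in increasing order), and $A[\alpha]=A[\alpha\mid\alpha]$. Blocks with no rows or no columns (e.g. when $i=1$ or $i=n$) are vacuous. *)

(* Defs.v *)
From mathcomp Require Import all_boot all_order all_algebra.

Set Implicit Arguments.
Unset Strict Implicit.
Unset Printing Implicit Defensive.

Import GRing.Theory.
Local Open Scope ring_scope.

Definition poset_mx (n : nat) (A : 'M[int]_n) : Prop :=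
  [/\ forall s t, A s t = 0 \/ A s t = 1,
      is_trig_mx A,
      forall s, A s s = 1
    & forall s t u, A s t = 1 -> A t u = 1 -> A s u = 1].

(* The submatrix A[alpha | beta]. The enumeration of a set of ordinals is
   increasing, so rows and columns keep their order. *)
Definition submx_on (R : Type) (p q : nat) (A : 'M[R]_(p, q))
    (alpha : {set 'I_p}) (beta : {set 'I_q}) : 'M[R]_(#|alpha|, #|beta|) :=
  mxsub enum_val enum_val A.

(* Indices start at 0: i : 'I_n stands for the 1-based index i.+1, so that
   [below i] is {1, ..., (i.+1) - 1} and [above i] is {(i.+1) + 1, ..., n}. *)
Definition below (n : nat) (i : 'I_n) : {set 'I_n} := [set s : 'I_n | (s < i)%N].
Definition above (n : nat) (i : 'I_n) : {set 'I_n} := [set s : 'I_n | (i < s)%N].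

Lemma card_below (n : nat) (i : 'I_n) : #|below i| = i.
Proof.
have inj_w : injective (widen_ord (ltnW (ltn_ord i))).
  by move=> s t /(congr1 val) /= /val_inj.
rewrite -[RHS]card_ord -(card_imset predT inj_w).
apply: eq_card => s; rewrite inE; apply/idP/imsetP => [lt_si|[t _ ->] /=].
  by exists (Ordinal lt_si) => //; apply: val_inj.
exact: ltn_ord.
Qed.

Lemma card_above (n : nat) (i : 'I_n) : #|above i| = (n - i.+1)%N.
Proof.
have cC : #|~: above i| = i.+1.
  have -> : ~: above i = i |: below i.
    by apply/setP => s; rewrite !inE -leqNgt leq_eqVlt.
  by rewrite cardsU1 card_below inE ltnn add1n.
by rewrite -[X in (X - _)%N]card_ord -(cardsC (above i)) cC addnK.
Qed.

Lemma insert_size (n m : nat) (i : 'I_n) :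
  (i + (m + (n - i.+1)) = n + m - 1)%N.
Proof. by rewrite -[in RHS](subnKC (ltn_ord i)) !addSn subn1 /= -addnA (addnC m). Qed.

Definition A11 (n : nat) (A : 'M[int]_n) (i : 'I_n) : 'M[int]_i :=
  castmx (card_below i, card_below i) (submx_on A (below i) (below i)).

Definition A22 (n : nat) (A : 'M[int]_n) (i : 'I_n) : 'M[int]_(n - i.+1) :=
  castmx (card_above i, card_above i) (submx_on A (above i) (above i)).

Definition A21 (n : nat) (A : 'M[int]_n) (i : 'I_n) : 'M[int]_(n - i.+1, i) :=
  castmx (card_above i, card_below i) (submx_on A (above i) (below i)).

(* The matrix C = / A11  0  0  \
                  |  U   B  0  |
                  \ A21  V A22 /, cast to order n + m - 1. *)
Definition insert_mx (n m : nat) (A : 'M[int]_n) (B : 'M[int]_m) (i : 'I_n)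
    (U : 'M[int]_(m, i)) (V : 'M[int]_(n - i.+1, m)) : 'M[int]_(n + m - 1) :=
  castmx (insert_size m i, insert_size m i)
    (block_mx (A11 A i)            0
              (col_mx U (A21 A i)) (block_mx B 0
                                             V (A22 A i))).

Notation ones := (const_mx 1).

(* Main.v *)
Require Import Defs.
From mathcomp Require Import all_boot all_order all_algebra.
Set Implicit Arguments.
Unset Strict Implicit.
Unset Printing Implicit Defensive.
Import GRing.Theory.
Local Open Scope ring_scope.

(** In each of the seven triples the blocks are constant, equal to bits [u], [v], [a] with
    [u && v ==> a]. Cut the block lower triangular matrix in two and apply [poset_mx_block] twice,
    first to [B], [V], [A22], then to [A11] and the rest. Chains with two consecutive indices in one
    block keep the value of a constant block, so only the implication on the bits has to be
    checked. *)

Lemma poset_mx_castmx (p q : nat) (e : p = q) (A : 'M[int]_p) :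
  poset_mx A -> poset_mx (castmx (e, e) A).
Proof. by case: q / e; rewrite castmx_id. Qed.

(** [enum S] is a subsequence of the increasing enumeration of ['I_n]. This keeps submatrices
    triangular. *)
Lemma ltn_enum_val (n : nat) (S : {set 'I_n}) (j k : 'I_#|S|) :
  (j < k)%N -> (enum_val j < enum_val k)%N.
Proof.
move=> lt_jk; pose r := relpre (@nat_of_ord n) ltn.
have r_trans : transitive r by move=> x y z; apply: ltn_trans.
have r_enum : sorted r (enum S).
  apply: (subseq_sorted r_trans (filter_subseq _ _)).
  by rewrite -sorted_map -enumT val_enum_ord iota_ltn_sorted.
have x0 := enum_val j; rewrite !(enum_val_nth x0).
by apply: (sorted_ltn_nth r_trans x0 r_enum); rewrite ?inE -?cardE.
Qed.

Lemma poset_mx_submx_on (n : nat) (A : 'M[int]_n) (S : {set 'I_n}) :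
  poset_mx A -> poset_mx (submx_on A S S).
Proof.
case=> A01 /is_trig_mxP Atrig Adiag Atrans; split.
- by move=> s t; rewrite mxE.
- by apply/is_trig_mxP => s t /ltn_enum_val/Atrig; rewrite mxE.
- by move=> s; rewrite mxE.
- by move=> s t u; rewrite !mxE; apply: Atrans.
Qed.

(** As the upper right block vanishes, a chain meeting both index ranges starts in the lower one and
    ends in the upper one; the last two hypotheses treat the two places of its middle index. *)
Lemma poset_mx_block (p q : nat) (P : 'M[int]_p) (Q : 'M[int]_(q, p))
    (R : 'M[int]_q) :
  poset_mx P -> poset_mx R ->
  (forall s t, Q s t = 0 \/ Q s t = 1) ->
  (forall s t u, Q s t = 1 -> P t u = 1 -> Q s u = 1) ->
  (forall s t u, R s t = 1 -> Q t u = 1 -> Q s u = 1) ->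
  poset_mx (block_mx P 0 Q R).
Proof.
move=> [P01 Ptrig Pdiag Ptrans] [R01 Rtrig Rdiag Rtrans] Q01 QP RQ; split.
- move=> s t; case: (split_ordP s) => s' ->; case: (split_ordP t) => t' ->.
  + by rewrite block_mxEul.
  + by rewrite block_mxEur mxE; left.
  + by rewrite block_mxEdl.
  + by rewrite block_mxEdr.
- by rewrite is_trig_block_mx // eqxx Ptrig.
- move=> s; case: (split_ordP s) => s' ->.
  + by rewrite block_mxEul.
  + by rewrite block_mxEdr.
(* Of the eight cases, four have a premise [0 = 1]. *)
- move=> s t u; case: (split_ordP s) => s' ->; case: (split_ordP t) => t' ->;
  case: (split_ordP u) => u' ->;
  rewrite ?block_mxEul ?block_mxEur ?block_mxEdl ?block_mxEdr ?[(0 : 'M_(_, _)) _ _]mxE //.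
  + exact: Ptrans.
  + exact: QP.
  + exact: RQ.
  + exact: Rtrans.
Qed.

(* The only chain through all three blocks goes from the last block through
   the middle one to the first: this is what excludes (J, J, O). *)
Lemma poset_mx_insert_const (n m : nat) (A : 'M[int]_n) (B : 'M[int]_m)
    (i : 'I_n) (u v a : bool) :
  poset_mx A -> poset_mx B -> A21 A i = const_mx a%:R -> u && v ==> a ->
  poset_mx (insert_mx A B (const_mx u%:R : 'M_(m, i)) (const_mx v%:R)).
Proof.
move=> hA hB eA21 uva; rewrite /insert_mx eA21; apply: poset_mx_castmx.
have b01 (b : bool) : b%:R = 0 :> int \/ b%:R = 1 :> int.
  by case: b; [right | left].
apply: poset_mx_block.
- exact/poset_mx_castmx/poset_mx_submx_on.
- apply: poset_mx_block => // [|s t|s t k|s t k]; rewrite ?mxE //.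
  exact/poset_mx_castmx/poset_mx_submx_on.
- by move=> s t; case: (split_ordP s) => s' ->; rewrite ?col_mxEu ?col_mxEd mxE.
- by move=> s t k; case: (split_ordP s) => s' ->; rewrite ?col_mxEu ?col_mxEd !mxE.
- move=> s t k; case: (split_ordP s) => s' ->; case: (split_ordP t) => t' ->;
  rewrite ?block_mxEul ?block_mxEur ?block_mxEdl ?block_mxEdr ?col_mxEu ?col_mxEd !mxE //.
  by case: u v a uva {eA21} => [] [] [].
Qed.

Theorem theorem1 (n m : nat) (A : 'M[int]_n) (B : 'M[int]_m) (i : 'I_n)
    (U : 'M[int]_(m, i)) (V : 'M[int]_(n - i.+1, m))
    (hA : poset_mx A) (hB : poset_mx B)
    (hUV : (U, V, A21 A i) \in
      [:: (ones, ones, ones); (0, 0, ones); (ones, 0, ones); (0, ones, ones);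
          (0, 0, 0); (0, ones, 0); (ones, 0, 0)]) :
  poset_mx (insert_mx A B U V).
Proof.
(* The implication excludes only one of the eight triples of bits. *)
have [u [v [a [-> -> eA21 uva]]]] : exists u v a : bool,
    [/\ U = const_mx u%:R, V = const_mx v%:R, A21 A i = const_mx a%:R
      & u && v ==> a].
  move: hUV; rewrite !inE.
  by do ?[case/orP]; move=> /eqP[-> -> ->];
    [exists true, true, true | exists false, false, true
    |exists true, false, true | exists false, true, true
    |exists false, false, false | exists false, true, false
    |exists true, false, false].
exact: poset_mx_insert_const eA21 uva.
Qed.
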